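(* Let $a=(a(n))_{n\ge 0}$ be an increasing real sequence with $a(n)\to\infty$ as $n\to\infty$. Let $k=(k(n))_{n\ge 0}$ be a real sequence with $\sum_{n=0}^\infty |k(n)|<\infty$, and suppose that the solution $r$ of the resolvent equation $r(n+1)=\sum_{j=0}^{n}k(n-j)r(j)$, $n\ge 0$, $r(0)=1$, satisfies $\sum_{n=0}^\infty |r(n)|<\infty$. Let $H=(H(n))_{n\ge 0}$ be a real sequence, $\xi\in\mathbb{R}$, and let $x$ be the solution of $$x(n+1)=\sum_{j=0}^{n}k(n-j)x(j)+H(n+1),\quad n\ge 0;\qquad x(0)=\xi.$$ Then: (a) $\Lambda_a|x|=0$ if and only if $\Lambda_a|H|=0$; (b) $\Lambda_a|x|\in(0,\infty)$ if and only if $\Lambda_a|H|\in(0,\infty)$; (c) $\Lambda_a|x|=+\infty$ if and only if $\Lambda_a|H|=+\infty$.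
   Context: For a real sequence $y=(y(n))_{n\ge 0}$, $\Lambda_a|y|:=\limsup_{n\to\infty}|y(n)|/a(n)\in[0,\infty]$. The value $H(0)$ does not enter the equation for $x$. *)

(* Defs.v *)
From mathcomp Require Import all_boot all_order all_algebra.
From mathcomp Require Import all_classical all_reals all_analysis.
Set Implicit Arguments.
Unset Strict Implicit.
Unset Printing Implicit Defensive.
Import Order.TTheory GRing.Theory Num.Theory.
Local Open Scope ring_scope.

(* Since a n -> +oo, the finitely many n with a n <= 0 (where the quotient may
   be junk) do not influence the limit superior. *)
Definition Lambda (R : realType) (a y : nat -> R) : \bar R :=
  limn_esup (fun n => (`|y n| / a n)%:E).

Definition summable_seq (R : realType) (u : nat -> R) : Prop :=
  (\sum_(0 <= n <oo) (`|u n|)%:E < +oo)%E.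

(* Main.v *)
Require Import Defs.
From mathcomp Require Import all_boot all_order all_algebra.
From mathcomp Require Import all_classical all_reals all_analysis.
Import Order.TTheory GRing.Theory Num.Theory.
Import numFieldNormedType.Exports.
Local Open Scope classical_set_scope.
Local Open Scope ring_scope.

(** The recurrence is a convolution equation. Let [kernel k] be the sequence
    1, -k(0), -k(1), ..., let G be H with its value at 0 replaced by [xi], and
    let delta be the unit of convolution. The equation for x then says
    kernel k * x = G, and the resolvent equation says kernel k * r = delta
    ([recurrence_conv]). Convolution being commutative and associative, r is
    the inverse of [kernel k], so that x = r * G ([conv_inverse]). Hence each
    of x and G is the convolution of the other with a summable sequence.

    Convolution with a summable sequence cannot spoil an eventual bound
    |y(n)| <= c a(n), except for a multiplicative constant
    ([eventual_bound_conv]): the terms in which the bound on y is available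
    are controlled because a is nondecreasing, and the finitely many other
    terms contribute a bounded amount, which a(n) eventually exceeds.

    Finally, Lambda_a|y| is zero, respectively finite, exactly when such a
    bound holds for every c > 0, respectively for some c > 0
    ([Lambda_eq0P], [Lambda_ltyP]). Therefore Lambda_a|x| and Lambda_a|H|
    vanish together and are finite together; being nonnegative, they also lie
    in (0, +oo) together. *)

(** * Convolution of sequences *)

Section Convolution.
Set Implicit Arguments.
Unset Strict Implicit.
Context {R : comNzRingType}.
Implicit Types u v w k y f : nat -> R.

Definition conv u v (n : nat) : R := \sum_(j < n.+1) u (n - j)%N * v j.

Definition delta (n : nat) : R := (n == 0%N)%:R.

Definition kernel k (n : nat) : R := if n is m.+1 then - k m else 1.

(** Convolutions up to a fixed index only see finitely many terms, so they are
    coefficients of products of polynomials; the algebraic laws of convolution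
    are inherited from the polynomial ring. *)
Lemma coef_mul_trunc u v N n : (n < N)%N ->
  ((\poly_(i < N) u i) * (\poly_(i < N) v i))`_n = conv u v n.
Proof.
move=> nN; rewrite coefMr; apply: eq_bigr => j _; rewrite !coef_poly.
have jn : (j <= n)%N by rewrite -ltnS.
by rewrite (leq_ltn_trans (leq_subr _ _) nN) (leq_ltn_trans jn nN).
Qed.

Lemma convC u v : conv u v = conv v u.
Proof.
by apply/funext => n; rewrite -!(@coef_mul_trunc _ _ n.+1)// mulrC.
Qed.

Lemma convA u v w : conv u (conv v w) = conv (conv u v) w.
Proof.
apply/funext => n.
set P := fun f : nat -> R => \poly_(i < n.+1) f i.
transitivity ((P u * (P v * P w))`_n).
  rewrite coefMr; apply: eq_bigr => j _.
  rewrite coef_mul_trunc ?coef_poly; last exact: ltn_ord.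
  by rewrite ltnS leq_subr.
rewrite mulrA coefMr; apply: eq_bigr => j _.
by rewrite coef_mul_trunc ?ltnS ?leq_subr// coef_poly ltn_ord.
Qed.

Lemma conv_delta u : conv delta u = u.
Proof.
apply/funext => n; rewrite convC /conv big_ord_recl subn0 /delta eqxx mulr1.
by rewrite big1 ?addr0// => i _; rewrite mulr0.
Qed.

(** Moving the convolution with k to the left-hand side: the leading 1 of
    [kernel k] contributes y(n+1), and its shifted tail the other terms. *)
Lemma recurrence_conv k f y :
  y 0%N = f 0%N -> (forall n, y n.+1 = conv k y n + f n.+1) ->
  conv (kernel k) y = f.
Proof.
move=> y0 yS; apply/funext => -[|n]; rewrite /conv.
  by rewrite big_ord1 /= mul1r.
rewrite big_ord_recr /= subnn mul1r yS addrA -[RHS]add0r; congr (_ + _).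
rewrite /conv -big_split/= big1// => j _.
by rewrite (subSn (ltn_ord j : (j <= n)%N)) /= mulNr addNr.
Qed.

(** If v is the inverse of u, then y = (v * u) * y = v * (u * y) = v * f. *)
Lemma conv_inverse u v y f :
  conv u v = delta -> conv u y = f -> y = conv v f.
Proof. by move=> uv <-; rewrite convA (convC v) uv conv_delta. Qed.

End Convolution.

(** * Eventual bounds *)

Section EventualBounds.
Set Implicit Arguments.
Unset Strict Implicit.
Context {R : realType}.
Implicit Types a w y z k : nat -> R.

Definition eventual_bound a y (c : R) := \forall n \near \oo, `|y n| <= c * a n.

(** The convolution identities have the initial datum of the recurrence at 0
    in place of H(0); this makes the difference invisible. *)
Lemma eventual_bound_eq_pos a y z c : (forall n, y n.+1 = z n.+1) ->
  eventual_bound a y c -> eventual_bound a z c.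
Proof.
by move=> yz; apply: filterS2 (nbhs_infty_gt 0%N) => -[|n]//= _; rewrite yz.
Qed.

Definition sum_norms_le w (W : R) := forall n, \sum_(i < n) `|w i| <= W.

Lemma summable_sum_norms_le w : summable_seq w ->
  exists2 W, 0 < W & sum_norms_le w W.
Proof.
rewrite /summable_seq; set S := (X in (X < _)%E) => Soo.
have S0 : (0 <= S)%E by apply: nneseries_ge0 => *; rewrite lee_fin.
have Sfin : S \is a fin_num by rewrite ge0_fin_numE.
exists (fine S + 1); first by rewrite ltr_wpDl// fine_ge0.
move=> n; rewrite (@le_trans _ _ (fine S))// ?lerDl//.
rewrite -lee_fin fineK// -sumEFin -(big_mkord xpredT (fun i => `|w i|%:E)).
by apply: nneseries_lim_ge => *; rewrite lee_fin.
Qed.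

Lemma kernel_sum_norms_le k K :
  sum_norms_le k K -> sum_norms_le (kernel k) (1 + K).
Proof.
move=> kK [|n].
  by rewrite big_ord0 addr_ge0// (le_trans _ (kK 0%N))// big_ord0.
rewrite big_ord_recl /= normr1 lerD2l.
by under eq_bigr do rewrite normrN; exact: kK.
Qed.

(** Let M be the sum of the |y(j)| over the finitely many j where the bound
    is not yet available. As a is nondecreasing, every j <= n satisfies
    |y(j)| <= M + c a(n), and M <= c a(n) for n large since a tends to
    infinity: this is where the factor 2 comes from. *)
Lemma eventual_bound_conv a w y (W c : R) :
  nondecreasing_seq a -> a n @[n --> \oo] --> +oo ->
  0 < c -> sum_norms_le w W ->
  eventual_bound a y c -> eventual_bound a (conv w y) (W *+ 2 * c).
Proof.
move=> a_nd a_oo c0 wW [N _ yN].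
pose M := \sum_(i < N) `|y i|.
have M0 : 0 <= M by rewrite sumr_ge0.
near=> n.
have Man : M <= c * a n.
  rewrite mulrC -ler_pdivrMr//; near: n.
  by move/cvgryPge : a_oo; exact.
have can0 : 0 <= c * a n := le_trans M0 Man.
have yle j : (j <= n)%N -> `|y j| <= (c * a n) *+ 2.
  move=> jn; rewrite mulr2n; have [jN|Nj] := ltnP j N.
    rewrite -[leLHS]addr0 lerD// (le_trans _ Man)// /M.
    by rewrite (bigD1 (Ordinal jN))//= lerDl sumr_ge0.
  by rewrite -[leLHS]add0r lerD// (le_trans (yN j Nj))// ler_pM2l// a_nd.
apply: le_trans (ler_norm_sum _ _ _) _.
rewrite mulrnAl -mulrnAr -mulrA mulrnAl.
apply: (@le_trans _ _ (\sum_(j < n.+1) `|w (n - j)%N| * ((c * a n) *+ 2))).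
  by apply: ler_sum => j _; rewrite normrM ler_wpM2l// yle// -ltnS.
rewrite -mulr_suml ler_wpM2r ?mulrn_wge0//.
(* The weights w(n - j) are the first n + 1 entries of w in reverse order. *)
rewrite (reindex_inj rev_ord_inj)/=.
under eq_bigr => j _ do rewrite subSS (subKn (ltn_ord j : (j <= n)%N)).
exact: wW.
Unshelve. all: by end_near.
Qed.

(** * Growth rates through eventual bounds *)

Lemma Lambda_le_of_bound a y c : a n @[n --> \oo] --> +oo ->
  eventual_bound a y c -> (Lambda a y <= c%:E)%E.
Proof.
move=> /cvgryPgt/(_ 0) a0 yc; apply: ge_ereal_inf.
pose V := [set n | 0 < a n /\ `|y n| <= c * a n].
have VF : \oo V by near=> n; split; near: n.
exists (ereal_sup ((fun n => (`|y n| / a n)%:E) @` V)); first by exists V.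
apply: ge_ereal_sup => _ [n [an yn] <-].
by rewrite lee_fin ler_pdivrMr.
Unshelve. all: by end_near.
Qed.

Lemma bound_of_Lambda_lt a y c : a n @[n --> \oo] --> +oo ->
  (Lambda a y < c%:E)%E -> eventual_bound a y c.
Proof.
move=> /cvgryPgt/(_ 0) a0 /ereal_inf_lt[_ [V VF <-] Vc].
near=> n.
have an : 0 < a n by near: n.
have Vn : V n by near: n.
rewrite -ler_pdivrMr// -lee_fin (le_trans _ (ltW Vc))//.
by apply: ereal_sup_ubound; exists n.
Unshelve. all: by end_near.
Qed.

(** The quotients can be negative where a(n) < 0, but every tail contains an
    index with a(n) > 0, which keeps the supremum over the tail nonnegative. *)
Lemma Lambda_ge0 a y : a n @[n --> \oo] --> +oo -> (0 <= Lambda a y)%E.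
Proof.
move=> /cvgryPgt/(_ 0) a0; apply: le_ereal_inf_tmp => _ [V VF <-].
have [n [an Vn]] := filter_ex (filterI a0 VF).
apply: (@le_trans _ _ (`|y n| / a n)%:E); first by rewrite lee_fin divr_ge0// ltW.
by apply: ereal_sup_ubound; exists n.
Qed.

Lemma Lambda_eq0P a y : a n @[n --> \oo] --> +oo ->
  Lambda a y = 0%E <-> forall c, 0 < c -> eventual_bound a y c.
Proof.
move=> a_oo; split=> [y0 c c0|yc].
  by apply: bound_of_Lambda_lt => //; rewrite y0 lte_fin.
apply/eqP; rewrite eq_le Lambda_ge0// andbT.
by apply/lee_addgt0Pr => c c0; rewrite add0e Lambda_le_of_bound//; exact: yc.
Qed.

Lemma Lambda_ltyP a y : a n @[n --> \oo] --> +oo ->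
  (Lambda a y < +oo)%E <-> exists2 c, 0 < c & eventual_bound a y c.
Proof.
move=> a_oo; split=> [yoo|[c _ yc]]; last first.
  by rewrite (le_lt_trans (Lambda_le_of_bound a_oo yc))// ltry.
have y0 := Lambda_ge0 y a_oo.
have yfin : Lambda a y \is a fin_num by rewrite ge0_fin_numE.
exists (fine (Lambda a y) + 1); first by rewrite ltr_wpDl// fine_ge0.
by apply: bound_of_Lambda_lt => //; rewrite -{1}(fineK yfin) lte_fin ltrDl.
Qed.

(** The constant C > 0 is harmless: for vanishing, c ranges over all positive
    reals and C^-1 * c does too; for finiteness, one c is enough. *)
Lemma Lambda_transfer a y z C : a n @[n --> \oo] --> +oo -> 0 < C ->
  (forall c, 0 < c -> eventual_bound a y c -> eventual_bound a z (C * c)) ->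
  (Lambda a y = 0%E -> Lambda a z = 0%E) /\
  ((Lambda a y < +oo)%E -> (Lambda a z < +oo)%E).
Proof.
move=> a_oo C0 yz; split.
  move=> /Lambda_eq0P-/(_ a_oo) y0; apply/Lambda_eq0P => // c c0.
  have c'0 : 0 < C^-1 * c by rewrite mulr_gt0// invr_gt0.
  by rewrite -(mulVKf (lt0r_neq0 C0) c); apply: yz => //; exact: y0.
move=> /Lambda_ltyP-/(_ a_oo)[c c0 yc]; apply/Lambda_ltyP => //.
by exists (C * c); [rewrite mulr_gt0|exact: yz].
Qed.

End EventualBounds.

(** * The growth rates of solution and forcing term *)

Theorem theorem3p1 (R : realType) (a k r H x : nat -> R) (xi : R)
    (a_incr : nondecreasing_seq a)
    (a_infty : a n @[n --> \oo] --> +oo)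
    (k_summable : summable_seq k)
    (r_init : r 0%N = 1)
    (r_rec : forall n : nat, r n.+1 = \sum_(j < n.+1) k (n - j)%N * r j)
    (r_summable : summable_seq r)
    (x_init : x 0%N = xi)
    (x_rec : forall n : nat,
       x n.+1 = \sum_(j < n.+1) k (n - j)%N * x j + H n.+1) :
  [/\ Lambda a x = 0%E <-> Lambda a H = 0%E,
      (0 < Lambda a x < +oo)%E <-> (0 < Lambda a H < +oo)%E
    & Lambda a x = +oo%E <-> Lambda a H = +oo%E].
Proof.
pose G n := if n is m.+1 then H n else xi.
have kxG : conv (kernel k) x = G by exact: recurrence_conv.
have krd : conv (kernel k) r = delta.
  by apply: recurrence_conv => // n; rewrite r_rec addr0.
have xrG : x = conv r G := conv_inverse krd kxG.
have [K K0 kK] := summable_sum_norms_le k_summable.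
have [S S0 rS] := summable_sum_norms_le r_summable.
have GH c : eventual_bound a G c <-> eventual_bound a H c.
  by split; exact: eventual_bound_eq_pos.
have [Hx0 Hxy] : (Lambda a H = 0%E -> Lambda a x = 0%E) /\
    ((Lambda a H < +oo)%E -> (Lambda a x < +oo)%E).
  apply: (@Lambda_transfer _ _ _ _ (S *+ 2)) => // [|c c0 /GH Gc].
    by rewrite mulrn_wgt0.
  by rewrite xrG; exact: eventual_bound_conv.
have [xH0 xHy] : (Lambda a x = 0%E -> Lambda a H = 0%E) /\
    ((Lambda a x < +oo)%E -> (Lambda a H < +oo)%E).
  apply: (@Lambda_transfer _ _ _ _ ((1 + K) *+ 2)) => // [|c c0 xc].
    by rewrite mulrn_wgt0// addr_gt0.
  apply/GH; rewrite -kxG; apply: eventual_bound_conv => //.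
  exact: kernel_sum_norms_le.
have eq0 : Lambda a x = 0%E <-> Lambda a H = 0%E by [].
have eqy : (Lambda a x < +oo)%E = (Lambda a H < +oo)%E by apply/idP/idP.
have gt0E y : (0 < Lambda a y)%E = (Lambda a y != 0%E).
  by rewrite lt0e Lambda_ge0// andbT.
have eqyP y : Lambda a y = +oo%E <-> ~~ (Lambda a y < +oo)%E.
  by rewrite ltey negbK; split => /eqP.
split=> //; last by rewrite !eqyP eqy.
rewrite !gt0E eqy; suff -> : (Lambda a x == 0%E) = (Lambda a H == 0%E) by [].
by apply/eqP/eqP.
Qed.
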